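(* Let $\mathbb{E}^n$ be Euclidean $n$-space and let $G\leq \mathrm{Isom}(\mathbb{E}^n)$ be a discrete subgroup. Then the quotient map $\mathbb{E}^n\to\mathbb{E}^n/G$ admits a continuous section if and only if $G$ is generated by affine reflections.
   Context: $\mathrm{Isom}(\mathbb{E}^n)$ is the group of isometries of $\mathbb{E}^n$ with its usual topology. $\mathbb{E}^n/G$ is the orbit space with the quotient topology. A continuous section of $q\colon\mathbb{E}^n\to\mathbb{E}^n/G$ is a continuous map $s\colon\mathbb{E}^n/G\to\mathbb{E}^n$ with $q\circ s=\mathrm{id}$. An affine reflection is an orthogonal reflection across an affine hyperplane of $\mathbb{E}^n$. ''Generated by affine reflections'' means generated by the affine reflections contained in $G$. *)

(* Defs.v *)
From HB Require Import structures.
From mathcomp Require Import all_boot all_order all_algebra.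
From mathcomp Require Import all_classical all_reals all_analysis.
Import Order.TTheory GRing.Theory Num.Theory.
Import numFieldNormedType.Exports.

Set Implicit Arguments.
Unset Strict Implicit.
Unset Printing Implicit Defensive.

Local Open Scope classical_set_scope.
Local Open Scope ring_scope.

Section Euclidean.
Context {R : realType} {n : nat}.
Implicit Types x y a : 'rV[R]_n.

Definition edot x y : R := \sum_(i < n) x 0 i * y 0 i.

(* The library norm on ['rV[R]_n] is the sup norm, hence this definition; the
   two norms induce the same topology, so the library topology is used as is. *)
Definition edist x y : R := Num.sqrt (edot (x - y) (x - y)).

(* Orthogonal reflection across the hyperplane [{x | edot a x = b}]; it is
   meaningful only for [a != 0]. *)
Definition hyperplane_reflection a (b : R) x : 'rV[R]_n :=
  x - (2 * (edot a x - b) / edot a a) *: a.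

End Euclidean.

Record eisom (R : realType) (n : nat) := EIsom {
  eisom_fun :> 'rV[R]_n -> 'rV[R]_n;
  eisom_bij : bijective eisom_fun;
  eisom_dist : forall x y, edist (eisom_fun x) (eisom_fun y) = edist x y
}.

Section IsometryGroup.
Context {R : realType} {n : nat}.
Local Notation E := ('rV[R]_n).
Implicit Types f g h : eisom R n.

Lemma eisom_eqP f g : f =1 g -> f = g.
Proof.
case: f g => [f fb fd] [g gb gd] /= /funext fg; case: _ / fg in gb gd *.
by rewrite (Prop_irrelevance fb gb) (Prop_irrelevance fd gd).
Qed.

Definition eisom_one : eisom R n :=
  @EIsom R n id (inv_bij (fun=> erefl)) (fun _ _ => erefl).

Lemma eisom_comp_bij f g : bijective (f \o g).
Proof. exact: bij_comp (eisom_bij f) (eisom_bij g). Qed.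

Lemma eisom_comp_dist f g x y : edist ((f \o g) x) ((f \o g) y) = edist x y.
Proof. by rewrite /= !eisom_dist. Qed.

Definition eisom_mul f g : eisom R n :=
  EIsom (eisom_comp_bij f g) (eisom_comp_dist f g).

Lemma eisom_surj f y : exists x, f x = y.
Proof. by have [k _ fk] := eisom_bij f; exists (k y). Qed.

Definition eisom_inv_fun f (y : E) : E := projT1 (cid (eisom_surj f y)).

Lemma eisom_invK f : cancel (eisom_inv_fun f) f.
Proof. by move=> y; exact: (projT2 (cid (eisom_surj f y))). Qed.

Lemma eisomK f : cancel f (eisom_inv_fun f).
Proof. by move=> x; apply: (bij_inj (eisom_bij f)); rewrite eisom_invK. Qed.

Lemma eisom_inv_bij f : bijective (eisom_inv_fun f).
Proof. by exists f; [exact: eisom_invK | exact: eisomK]. Qed.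

Lemma eisom_inv_dist f x y :
  edist (eisom_inv_fun f x) (eisom_inv_fun f y) = edist x y.
Proof. by rewrite -(eisom_dist f) !eisom_invK. Qed.

Definition eisom_inv f : eisom R n :=
  EIsom (eisom_inv_bij f) (eisom_inv_dist f).

Lemma eisom_mulA : associative eisom_mul.
Proof. by move=> f g h; exact: eisom_eqP. Qed.

Lemma eisom_mul1 : left_id eisom_one eisom_mul.
Proof. by move=> f; exact: eisom_eqP. Qed.

Lemma eisom_1mul : right_id eisom_one eisom_mul.
Proof. by move=> f; exact: eisom_eqP. Qed.

Lemma eisom_mulV : left_inverse eisom_one eisom_inv eisom_mul.
Proof. by move=> f; apply: eisom_eqP => x /=; exact: eisomK. Qed.

Lemma eisom_Vmul : right_inverse eisom_one eisom_inv eisom_mul.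
Proof. by move=> f; apply: eisom_eqP => x /=; exact: eisom_invK. Qed.

HB.instance Definition _ := gen_eqMixin (eisom R n).
HB.instance Definition _ := gen_choiceMixin (eisom R n).
HB.instance Definition _ := isGroup.Build (eisom R n)
  eisom_mulA eisom_mul1 eisom_1mul eisom_mulV eisom_Vmul.

(* On isometries the compact-open topology is the topology of pointwise
   convergence, i.e., the Lie group topology of [O(n) |x R^n]. *)
HB.instance Definition _ := Topological.copy (eisom R n)
  (initial_topology (@eisom_fun R n : eisom R n -> {compact-open, E -> E})).

Definition is_affine_reflection g : Prop :=
  exists a : E, exists b : R, a != 0 /\ g =1 hyperplane_reflection a b.

End IsometryGroup.

Definition generated_subgroup (gT : groupType) (A : set gT) : set gT :=
  smallest [set H : set gT | group_closed [pred x | x \in H]] A.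

Section OrbitSpace.
Local Open Scope quotient_scope.
Context {R : realType} {n : nat} (G : groupClosed (eisom R n)).
Local Notation E := ('rV[R]_n).

Definition same_orbit : rel E := fun x y => `[< exists2 g, g \in G & g x = y >].

Lemma same_orbit_refl : reflexive same_orbit.
Proof. by move=> x; apply/asboolP; exists 1%g => //; exact: gpred1. Qed.

Lemma same_orbit_sym : symmetric same_orbit.
Proof.
have H x y : same_orbit x y -> same_orbit y x.
  move=> /asboolP[g gG <-]; apply/asboolP; exists (g^-1)%g; first by rewrite gpredV.
  exact: eisomK.
by move=> x y; apply/idP/idP; exact: H.
Qed.

Lemma same_orbit_trans : transitive same_orbit.
Proof.
move=> y x z /asboolP[g gG <-] /asboolP[h hG <-]; apply/asboolP.
by exists (h * g)%g => //; exact: gpredM.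
Qed.

Canonical same_orbit_equiv :=
  EquivRel same_orbit same_orbit_refl same_orbit_sym same_orbit_trans.

Definition orbit_space := quotient_topology {eq_quot same_orbit_equiv}.

Definition orbit_map : E -> orbit_space := \pi_orbit_space.

End OrbitSpace.

(* Main.v *)
Require Import Defs.
From HB Require Import structures.
From mathcomp Require Import all_boot all_order all_algebra.
From mathcomp Require Import all_classical all_reals all_analysis.
From mathcomp Require Import ring lra.
Import Order.TTheory GRing.Theory Num.Theory.
Import numFieldNormedType.Exports.

(* If [s] is a continuous section, write [x = g_x (s [x])] with [g_x] in [G], and
   let [H] be the subgroup generated by the reflections of [G]. Near a point whose
   stabilizer lies in [H], the coset [H g_x] is well defined and locally constant.
   The other points lie on the fixed-point sets of elements of [G] that are neither
   trivial nor reflections; these have codimension at least 2 and are locally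
   finite, so a generic two-segment path from a point [p] of the image of [s] to
   [g p] avoids them, whence [g] belongs to [H].

   Conversely, fix a point [p] with trivial stabilizer and send an orbit to its
   point closest to [p]. Closest points lie in the closed chamber of [p], and the
   chamber meets each orbit once: [G] is generated by the reflections whose mirror
   is the only one separating [p] from its image, and the exchange condition for
   words in these generators gives uniqueness by induction on the length. *)

Set Implicit Arguments.
Unset Strict Implicit.
Unset Printing Implicit Defensive.

Local Open Scope classical_set_scope.
Local Open Scope ring_scope.

(* Otherwise [edist] is the extended distance of MathComp-Analysis. *)
Local Notation edist := Defs.edist.

(** * Euclidean geometry *)

Section EuclideanGeometry.
Context {R : realType} {n : nat}.
Local Notation E := ('rV[R]_n).
Implicit Types x y z a : E.

Lemma edotC x y : edot x y = edot y x.
Proof. by apply: eq_bigr => i _; rewrite mulrC. Qed.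

Lemma edotDl x y z : edot (x + y) z = edot x z + edot y z.
Proof. by rewrite /edot -big_split; apply: eq_bigr => i _; rewrite mxE mulrDl. Qed.

Lemma edotZl (k : R) x y : edot (k *: x) y = k * edot x y.
Proof. by rewrite /edot mulr_sumr; apply: eq_bigr => i _; rewrite mxE mulrA. Qed.

Lemma edotNl x y : edot (- x) y = - edot x y.
Proof. by rewrite -scaleN1r edotZl mulN1r. Qed.

Lemma edotDr x y z : edot z (x + y) = edot z x + edot z y.
Proof. by rewrite !(edotC z) edotDl. Qed.

Lemma edotZr (k : R) x y : edot y (k *: x) = k * edot y x.
Proof. by rewrite !(edotC y) edotZl. Qed.

Lemma edotNr x y : edot y (- x) = - edot y x.
Proof. by rewrite !(edotC y) edotNl. Qed.

Definition edotE := (edotDl, edotDr, edotNl, edotNr, edotZl, edotZr).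

Lemma edot_ge0 x : 0 <= edot x x.
Proof. by apply: sumr_ge0 => i _; rewrite -expr2 sqr_ge0. Qed.

Lemma edot_eq0 x : (edot x x == 0) = (x == 0).
Proof.
apply/eqP/eqP => [|->]; last by rewrite -(scale0r 0) edotZl mul0r.
move/eqP; rewrite psumr_eq0 => [/allP x0|i _]; last by rewrite -expr2 sqr_ge0.
apply/rowP => i; have := x0 i (mem_index_enum i).
by rewrite /= -expr2 sqrf_eq0 mxE => /eqP.
Qed.

Lemma edot_gt0 x : (0 < edot x x) = (x != 0).
Proof. by rewrite lt_def edot_eq0 edot_ge0 andbT. Qed.

Lemma edist_ge0 x y : 0 <= edist x y.
Proof. exact: sqrtr_ge0. Qed.

Lemma sqr_edist x y : edist x y ^+ 2 = edot (x - y) (x - y).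
Proof. by rewrite sqr_sqrtr // edot_ge0. Qed.

Lemma edistC x y : edist x y = edist y x.
Proof. by rewrite /edist -opprB edotNl edotNr opprK. Qed.

Lemma edistxx x : edist x x = 0.
Proof. by apply/eqP; rewrite -sqrf_eq0 sqr_edist edot_eq0 subrr. Qed.

Lemma edist_eq0 x y : (edist x y == 0) = (x == y).
Proof. by rewrite -sqrf_eq0 sqr_edist edot_eq0 subr_eq0. Qed.

Lemma edist_gt0 x y : (0 < edist x y) = (x != y).
Proof. by rewrite lt_def edist_eq0 edist_ge0 andbT. Qed.

Lemma le_edist x y z t :
  (edist x y <= edist z t) = (edot (x - y) (x - y) <= edot (z - t) (z - t)).
Proof. by rewrite -!sqr_edist ler_pXn2r // nnegrE edist_ge0. Qed.

Lemma lt_edist x y z t :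
  (edist x y < edist z t) = (edot (x - y) (x - y) < edot (z - t) (z - t)).
Proof. by rewrite !ltNge le_edist. Qed.

Lemma edist_eq x y z t :
  edist x y = edist z t -> edot (x - y) (x - y) = edot (z - t) (z - t).
Proof. by rewrite -!sqr_edist => ->. Qed.

(** Cauchy-Schwarz: the squared length of [edot y y *: x - edot x y *: y] is [edot y y] times the
    difference of the two sides. *)
Lemma edot_sqr_le x y : edot x y ^+ 2 <= edot x x * edot y y.
Proof.
have [->|y0] := eqVneq y 0.
  by rewrite -(scale0r 0) !edotZr !mul0r mulr0 expr0n.
have := edot_ge0 (edot y y *: x - edot x y *: y).
rewrite !edotE (edotC y x).
set d := edot y y; have d0 : 0 < d by rewrite edot_gt0.
move=> h; rewrite -subr_ge0 -(pmulr_rge0 _ d0).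
by apply: le_trans h _; rewrite le_eqVlt; apply/orP; left; apply/eqP; ring.
Qed.

Lemma ler_edistD y x z : edist x z <= edist x y + edist y z.
Proof.
rewrite -(ler_pXn2r (n := 2)) // ?nnegrE ?addr_ge0 ?edist_ge0 //.
rewrite sqrrD !sqr_edist.
have -> : x - z = (x - y) + (y - z) by rewrite addrA subrK.
set u := x - y; set v := y - z.
have h : edot u v <= edist x y * edist y z.
  apply: le_trans (ler_norm _) _.
  rewrite -(ler_pXn2r (n := 2)) // ?nnegrE ?mulr_ge0 ?edist_ge0 //.
  by rewrite real_normK ?num_real // exprMn !sqr_edist edot_sqr_le.
clearbody u v; rewrite !edotE (edotC v u); lra.
Qed.

Lemma coord_le_edist x y i : `|x 0 i - y 0 i| <= edist x y.
Proof.
rewrite -(ler_pXn2r (n := 2)) // ?nnegrE ?edist_ge0 // sqr_edist.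
rewrite real_normK ?num_real // /edot (bigD1 i) //= !mxE expr2 lerDl.
by apply: sumr_ge0 => j _; rewrite -expr2 sqr_ge0.
Qed.

Lemma edist_le_coord x y (e : R) : 0 <= e ->
  (forall i, `|x 0 i - y 0 i| <= e) -> edist x y <= n%:R * e.
Proof.
move=> e0 xye; rewrite -(ler_pXn2r (n := 2)) // ?nnegrE ?edist_ge0 ?mulr_ge0 //.
rewrite sqr_edist /edot; apply: (@le_trans _ _ (\sum_(i < n) e ^+ 2)).
  apply: ler_sum => i _; rewrite !mxE -expr2 -real_normK ?num_real //.
  by rewrite ler_pXn2r // nnegrE.
rewrite sumr_const card_ord -[leLHS]mulr_natl exprMn ler_wpM2r ?sqr_ge0 //.
by rewrite -natrX ler_nat; case: (n) => // m; rewrite leq_pmulr.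
Qed.

Lemma nbhs_edistP x (A : set E) :
  nbhs x A <-> exists2 e : R, 0 < e & forall y, edist x y < e -> A y.
Proof.
split=> [/nbhs_ballP [e /= e0 xeA]|[e e0 xeA]].
  exists e => // y xye; apply: xeA; split => // i j; rewrite ord1.
  by apply: le_lt_trans xye; exact: coord_le_edist.
(* [n.+1] keeps the divisor nonzero for [n = 0] and makes [n * (e / n.+1) < e] strict. *)
have d0 : 0 < e / n.+1%:R by rewrite divr_gt0.
apply/nbhs_ballP; exists (e / n.+1%:R) => //= y [_ xy].
apply: xeA; apply: le_lt_trans (_ : n%:R * (e / n.+1%:R) < _).
  by apply: edist_le_coord (ltW d0) _ => i; apply: ltW; exact: xy.
rewrite mulrCA -[ltRHS]mulr1 ltr_pM2l // ltr_pdivrMr // mul1r ltr_nat.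
exact: ltnSn.
Qed.

Lemma continuous_edistP (f : E -> E) :
  continuous f <-> forall x (e : R), 0 < e ->
    exists2 d : R, 0 < d & forall y, edist x y < d -> edist (f x) (f y) < e.
Proof.
split=> [cf x e e0|cf x A].
  have /cf/nbhs_edistP// : nbhs (f x) [set y | edist (f x) y < e].
  by apply/nbhs_edistP; exists e.
move=> /nbhs_edistP[e e0 fxA]; apply/nbhs_edistP.
by have [d d0 fd] := cf x e e0; exists d => // y /fd/fxA.
Qed.

End EuclideanGeometry.

(** * Isometries and reflections *)

Section Reflections.
Context {R : realType} {n : nat}.
Local Notation E := ('rV[R]_n).
Implicit Types (x y z a p : E) (g r : eisom R n).

Lemma eisomME g h x : (g * h)%g x = g (h x).
Proof. by []. Qed.

Lemma eisom1E x : (1%g : eisom R n) x = x.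
Proof. by []. Qed.

Lemma eisomVK g : cancel g (g^-1)%g.
Proof. exact: eisomK. Qed.

Lemma eisomKV g : cancel (g^-1)%g g.
Proof. exact: eisom_invK. Qed.

Definition linear_part g x : E := g x - g 0.

Lemma edot_linear_part g x y :
  edot (linear_part g x) (linear_part g y) = edot x y.
Proof.
have := edist_eq (eisom_dist g x 0); rewrite subr0 -/(linear_part g x).
have := edist_eq (eisom_dist g y 0); rewrite subr0 -/(linear_part g y).
have := edist_eq (eisom_dist g x y).
have -> : g x - g y = linear_part g x - linear_part g y.
  by rewrite /linear_part opprB addrA subrK.
move: (linear_part g x) (linear_part g y) => u v.
rewrite !edotE (edotC y x) (edotC v u); lra.
Qed.

(** The squared length of the difference of the two sides expands into inner products of images; by
    [edot_linear_part] these can be computed before applying [linear_part], where they cancel. *)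
Lemma linear_partP g x (t : R) y :
  linear_part g (x + t *: y) = linear_part g x + t *: linear_part g y.
Proof.
apply/eqP; rewrite -subr_eq0 -edot_eq0 opprD.
move: (linear_part g) (edot_linear_part g) => l lE.
by rewrite !edotE !lE !edotE (edotC y x); apply/eqP; ring.
Qed.

Lemma eisomP g x (t : R) y : g (x + t *: y) = g x + t *: linear_part g y.
Proof.
have := linear_partP g x t y.
by rewrite /linear_part addrAC => /addIr.
Qed.

Lemma hyperplane_reflectionZ a (b c : R) : c != 0 ->
  hyperplane_reflection (c *: a) (c * b) =1 hyperplane_reflection a b.
Proof.
move=> c0 x; rewrite /hyperplane_reflection scalerA !edotE.
have [->|a0] := eqVneq a 0; first by rewrite !scaler0.
congr (_ - _ *: _); have := a0; rewrite -edot_eq0 => a1; field.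
by rewrite a1 c0.
Qed.

Lemma hyperplane_reflection_unit a (b : R) x : edot a a = 1 ->
  hyperplane_reflection a b x = x - (2 * (edot a x - b)) *: a.
Proof. by move=> a1; rewrite /hyperplane_reflection a1 divr1. Qed.

Lemma reflection_bisector x y : x != y ->
  hyperplane_reflection (y - x) ((edot y y - edot x x) / 2) x = y.
Proof.
move=> xy; have : edot (y - x) (y - x) != 0.
  by rewrite edot_eq0 subr_eq0 eq_sym.
move=> d0; rewrite /hyperplane_reflection.
have -> : 2 * (edot (y - x) x - (edot y y - edot x x) / 2) / edot (y - x) (y - x)
   = -1.
  apply: (mulIf d0); rewrite divfK // mulN1r !edotE (edotC x y); field=> //.
by rewrite scaleN1r opprK addrC subrK.
Qed.

Lemma reflection_fixE a (b : R) x : a != 0 ->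
  (hyperplane_reflection a b x == x) = (edot a x == b).
Proof.
move=> a0; rewrite -subr_eq0 addrAC subrr add0r oppr_eq0 scaler_eq0 (negbTE a0).
rewrite orbF mulf_eq0 invr_eq0 edot_eq0 (negbTE a0) orbF mulf_eq0.
by rewrite pnatr_eq0 /= subr_eq0.
Qed.

(** The last product is that of the signed distances of [x] and [y] to the mirror, so comparing the
    distances from [x] to [y] and to [r y] reduces to a sign. *)
Lemma edot_reflection a (b : R) x y : edot a a = 1 ->
  let r := hyperplane_reflection a b in
  edot (x - r y) (x - r y) =
  edot (x - y) (x - y) + 4 * ((edot a x - b) * (edot a y - b)).
Proof.
move=> a1 /=; rewrite hyperplane_reflection_unit // opprB.
rewrite !edotE !(edotC _ a) a1; move: (edot a x) (edot a y) => s t.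
rewrite (edotC y x); ring.
Qed.

Lemma affine_reflection_unit r p : is_affine_reflection r -> r p != p ->
  exists a, exists b, [/\ edot a a = 1, 0 < edot a p - b &
                          r =1 hyperplane_reflection a b].
Proof.
move=> [a [b [a0 rE]]] rp.
have f0 : edot a p - b != 0 by rewrite subr_eq0 -reflection_fixE // -rE.
have aa : 0 < edot a a by rewrite edot_gt0.
have s0 : Num.sqrt (edot a a) != 0 by rewrite sqrtr_eq0 -ltNge.
(* The sign turns the normal towards [p], the root makes it a unit vector. *)
pose c := Num.sg (edot a p - b) / Num.sqrt (edot a a).
have c0 : c != 0 by rewrite mulf_neq0 ?invr_eq0 // sgr_eq0.
exists (c *: a), (c * b); split.
- rewrite !edotE mulrA -expr2 expr_div_n sqr_sqrtr ?ltW // sqr_sg f0.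
  by rewrite mul1r mulVf // gt_eqF.
- rewrite edotZl -mulrBr mulrAC -normrEsg divr_gt0 ?normr_gt0 //.
  by rewrite sqrtr_gt0.
- by move=> x; rewrite hyperplane_reflectionZ.
Qed.

Lemma affine_reflection_conj g r :
  is_affine_reflection r -> is_affine_reflection (g * r * g^-1)%g.
Proof.
move=> [a [b [a0 rE]]]; exists (linear_part g a).
exists (b + edot (linear_part g a) (g 0)); split.
  by rewrite -edot_eq0 edot_linear_part edot_eq0.
move=> y; rewrite -[y in RHS](eisomKV g) !eisomME rE.
move: ((g^-1)%g y) => {y} x; rewrite /hyperplane_reflection -scaleNr eisomP scaleNr.
congr (_ - _ *: _); rewrite edot_linear_part.
suff -> : edot (linear_part g a) (g x) - (b + edot (linear_part g a) (g 0)) =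
  edot a x - b by [].
by rewrite -(edot_linear_part g a x) [linear_part g x]/linear_part edotDr edotNr; ring.
Qed.

Lemma affine_reflection_invol r : is_affine_reflection r -> (r * r)%g = 1%g.
Proof.
move=> [a [b [a0 rE]]]; apply: eisom_eqP => x; rewrite eisomME !rE eisom1E.
have : edot a a != 0 by rewrite edot_eq0.
rewrite /hyperplane_reflection => aa; rewrite -addrA -opprD -scalerDl.
rewrite -[RHS]subr0; congr (_ - _); apply/eqP.
by rewrite scaler_eq0 (negbTE a0) orbF !edotE; apply/eqP; field.
Qed.

End Reflections.

(** * Discrete groups of isometries *)

Section Discreteness.
Context {R : realType} {n : nat}.
Local Notation E := ('rV[R]_n).
Implicit Types (x y z a p : E) (g h : eisom R n).

Lemma edist_le_norm x (M : R) : `|x| <= M -> edist x 0 <= n%:R * (M + 1).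
Proof.
move=> xM; have M0 : 0 <= M := le_trans (normr_ge0 x) xM.
have : ball x (M + 1) 0.
  by rewrite -ball_normE /ball_ /= subr0 (le_lt_trans xM) // ltrDl.
move=> [_ xb]; apply: edist_le_coord => [|i]; first by rewrite addr_ge0.
by apply: ltW; exact: xb.
Qed.

(** One parameter [e] governs both the radius [e^-1] of a ball and the error allowed on it. The
    filter generated by these conditions converges to [id] uniformly on compact sets, hence in the
    compact-open topology. *)
Lemma nbhs_compact_open_id (A : set (E -> E)) :
  nbhs (id : {compact-open, E -> E}) A ->
  exists2 e : R, 0 < e &
    forall f : E -> E, (forall x, edist x 0 <= e^-1 -> edist x (f x) < e) -> A f.
Proof.
pose B (e : R) := [set f : E -> E |
  forall x, edist x 0 <= e^-1 -> edist x (f x) < e].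
pose F : set_system (E -> E) := filter_from [set e : R | 0 < e] B.
have FF : Filter F.
  apply: filter_from_filter; first by exists 1 => /=.
  move=> i j /= i0 j0; exists (Num.min i j); first by rewrite /= lt_min i0.
  move=> f fB; split=> x xi; apply: lt_le_trans (fB x _) _;
    rewrite ?ge_min ?lexx ?orbT //; apply: le_trans xi _;
    by rewrite lef_pV2 ?posrE ?lt_min ?i0 // ge_min lexx ?orbT.
suff : {compact-open, F --> (id : E -> E)} by apply.
apply/compact_open_fam_compactP; first by move=> x; exact: cvg_id.
apply/fam_cvgP => K cK P /uniform_nbhs [V [entV VP]].
have [M [_ KM]] := compact_bounded cK.
move: entV; rewrite -entourage_ballE => -[d /= d0 dV].
pose M' := Num.max (n%:R * (M + 1 + 1)) 1.
have M'0 : 0 < M' by rewrite lt_max ltr01 orbT.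
pose e := Num.min M'^-1 d.
have e0 : 0 < e by rewrite lt_min invr_gt0 M'0.
exists e => //= f Bf; apply: VP => y Ky; apply: dV => /=.
split=> // i j; rewrite ord1; apply: le_lt_trans (coord_le_edist _ _ _) _.
apply: lt_le_trans (Bf y _) _; last by rewrite ge_min lexx orbT.
apply: (@le_trans _ _ M').
  rewrite le_max; apply/orP; left; apply: edist_le_norm.
  by apply: KM => //; rewrite ltrDl.
by rewrite -[leLHS]invrK lef_pV2 ?posrE ?invr_gt0 // ge_min lexx.
Qed.

(* The values at these [n + 1] points determine an isometry, and control it on
   bounded sets. *)
Definition frame_point (k : option 'I_n) : E :=
  if k is Some i then delta_mx 0 i else 0.

Lemma linear_part_sum g x :
  linear_part g x = \sum_i x 0 i *: linear_part g (delta_mx 0 i).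
Proof.
rewrite {1}[x]row_sum_delta.
elim: (index_enum _) => [|i s IH]; first by rewrite !big_nil /linear_part subrr.
by rewrite !big_cons addrC linear_partP IH addrC.
Qed.

Lemma eisom_near_id (e M : R) : 0 < e -> 0 <= M ->
  exists2 d : R, 0 < d & forall g,
    (forall k, edist (g (frame_point k)) (frame_point k) <= d) ->
    forall x, edist x 0 <= M -> edist x (g x) < e.
Proof.
(* Each coordinate of [x] moves by at most [d * (1 + n * (M * 2))]: [d] for the origin and, for each
   basis vector, a coefficient bounded by [M] times a difference of two displacements. The sum over
   [n] coordinates is [d * (c - 1)]; the final [1] makes the estimate strict. *)
move=> e0 M0; pose c := n%:R * (1 + n%:R * (M * 2)) + 1.
have n0 : 0 <= n%:R :> R by [].
have c0 : 0 < c by rewrite ltr_wpDl // mulr_ge0 // addr_ge0 // !mulr_ge0.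
exists (e / c); first by rewrite divr_gt0.
set d := e / c; have d0 : 0 < d by rewrite divr_gt0.
move=> g gd x xM; apply: (@le_lt_trans _ _ (n%:R * (d * (1 + n%:R * (M * 2))))).
  apply: edist_le_coord.
    by apply: mulr_ge0 (ltW d0) _; rewrite addr_ge0 // !mulr_ge0.
  move=> j; rewrite distrC.
  have g0 : `|g 0 0 j| <= d.
    have := le_trans (coord_le_edist _ _ j) (gd None).
    by rewrite /= [X in _ - X]mxE subr0.
  have -> : g x 0 j - x 0 j =
     g 0 0 j + \sum_i x 0 i * ((g (delta_mx 0 i) 0 j - (delta_mx 0 i : E) 0 j) - g 0 0 j).
    have -> : g x = g 0 + linear_part g x by rewrite /linear_part addrC subrK.
    rewrite linear_part_sum {2}[x]row_sum_delta mxE -addrA !summxE.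
    congr (_ + _); rewrite -sumrB; apply: eq_bigr => i _.
    by rewrite /linear_part !mxE -mulrBr; congr (_ * _); ring.
  apply: le_trans (ler_normD _ _) _; rewrite mulrDr mulr1 lerD //.
  apply: le_trans (ler_norm_sum _ _ _) _.
  have -> : d * (n%:R * (M * 2)) = \sum_(i < n) M * (d + d).
    by rewrite sumr_const card_ord -mulr_natl; ring.
  apply: ler_sum => i _; rewrite normrM ler_pM //.
    apply: le_trans xM; have := coord_le_edist x 0 i.
    by rewrite [X in _ - X]mxE subr0.
  apply: le_trans (ler_normB _ _) _; rewrite lerD //.
  exact: le_trans (coord_le_edist _ _ j) (gd (Some i)).
have -> : n%:R * (d * (1 + n%:R * (M * 2))) = d * (c - 1) by rewrite /c; ring.
rewrite mulrBr /d divfK ?gt_eqF // mulr1 ltrBlDr ltrDl; exact: d0.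
Qed.

Variable G : groupClosed (eisom R n).
Hypothesis G_discrete : [set` G] `<=` isolated [set` G].

Lemma discrete_near_id : exists2 d : R, 0 < d & forall g, g \in G ->
  (forall k, edist (g (frame_point k)) (frame_point k) <= d) -> g = 1%g.
Proof.
have [_ [V V1 VG]] := G_discrete (@gpred1 _ G : [set` G] 1%g).
move: V1; rewrite nbhsE => -[W [[U oU UW] W1] WV].
have U1 : nbhs (id : {compact-open, E -> E}) U.
  by apply: open_nbhs_nbhs; split => //; move: W1; rewrite -UW.
have [e e0 eU] := nbhs_compact_open_id U1.
have [d d0 dP] := eisom_near_id e0 (ltW (etrans (invr_gt0 e) e0)).
exists d => // g gG gd.
suff : (V `&` [set` G]) g by rewrite VG.
split=> //; apply: WV; rewrite -UW; apply: eU => x xe; exact: dP.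
Qed.

(** Pigeonhole: the images of the frame points stay in a box, cut into cells of side [e]. If [g] and
    [h] have the same cells, then [h^-1 * g] moves the frame points by at most [d] and so is
    trivial. *)
Lemma discrete_finite x p (B : R) :
  finite_set [set g | g \in G /\ edist (g x) p <= B].
Proof.
have [d d0 dP] := discrete_near_id.
set A := (X in finite_set X).
have [C CP] : exists C : R, forall g k j, A g -> `|g (frame_point k) 0 j| <= C.
  pose D k := B + edist (frame_point k) x + edist p 0.
  have DP g k j : A g -> `|g (frame_point k) 0 j| <= D k.
    move=> [_ gB]; have := coord_le_edist (g (frame_point k)) 0 j.
    rewrite [X in _ - X]mxE subr0 => /le_trans; apply.
    apply: le_trans (ler_edistD p _ _) _; rewrite lerD2r.
    apply: le_trans (ler_edistD (g x) _ _) _.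
    by rewrite eisom_dist addrC lerD2r.
  exists (\sum_k `|D k|) => g k j Ag; apply: le_trans (DP _ _ _ Ag) _.
  rewrite (bigD1 k) //= (le_trans (ler_norm _)) // lerDl.
  by apply: sumr_ge0.
pose e := d / n.+1%:R; have e0 : 0 < e by rewrite divr_gt0.
pose N := Num.truncn ((C + C) / e).
pose code g (k : option 'I_n * 'I_n) :=
  Num.truncn ((g (frame_point k.1) 0 k.2 + C) / e).
pose f g := [ffun k => (inord (code g k) : 'I_N.+1)].
suff injf : {in A &, injective f}.
  by rewrite -(eq_finite_set (inj_card_eq injf)); exact: finite_finset.
move=> g h /[!inE] Ag Ah /ffunP fgh.
have cge0 g' k : A g' -> 0 <= (g' (frame_point k.1) 0 k.2 + C) / e.
  move=> Ag'; apply: divr_ge0 (ltW e0).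
  by have := CP _ k.1 k.2 Ag'; rewrite ler_norml => /andP[+ _]; lra.
have codeK g' k : A g' -> (code g' k < N.+1)%N.
  move=> Ag'; rewrite ltnS /code /N; apply: le_truncn.
  rewrite ler_pM2r ?invr_gt0 // lerD2r.
  by apply: le_trans (ler_norm _) _; exact: CP.
have gh k : `|g (frame_point k.1) 0 k.2 - h (frame_point k.1) 0 k.2| <= e.
  have : code g k = code h k.
    have /(congr1 val) := fgh k; rewrite !ffunE /= !inordK ?codeK //.
  have := truncn_itv (cge0 _ k Ag); have := truncn_itv (cge0 _ k Ah).
  rewrite -/(code g k) -/(code h k) => + + gh; rewrite gh.
  move: (code h k) => m; rewrite -natr1.
  move=> /andP[+ +] /andP[+ +].
  rewrite ler_pdivlMr // ltr_pdivrMr // ler_pdivlMr // ltr_pdivrMr //.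
  move=> h1 h2 h3 h4; by rewrite ler_norml; apply/andP; split; lra.
apply/eqP; rewrite eq_sym -[h == g]divg_eq1; apply/eqP/invg_inj.
rewrite invgF invg1.
have : (h^-1 * g)%g = 1%g.
  apply: dP; first by apply: gpredM; [rewrite gpredV; case: Ah | case: Ag].
  move=> k; rewrite -(eisom_dist h) eisomME eisomKV.
  apply: (@le_trans _ _ (n%:R * e)).
    by apply: edist_le_coord (ltW e0) _ => j; exact: (gh (k, j)).
  by rewrite /e mulrCA ger_pMr // ler_pdivrMr // mul1r ler_nat.
by move=> hg; rewrite -(mulVKg h g) hg mulg1 mulgV.
Qed.

Lemma discrete_argmin x p (B : R) (A : set (eisom R n)) (f : eisom R n -> R) :
  A !=set0 -> (forall g, A g -> g \in G /\ edist (g x) p <= B) ->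
  exists2 g, A g & forall h, A h -> f g <= f h.
Proof.
move=> [g0 Ag0] AG.
have /finite_seqP[s sA] : finite_set A.
  by apply: sub_finite_set (discrete_finite x p B) => g /AG.
have : s != [::] by apply/eqP => s0; move: Ag0; rewrite sA s0.
have -> : A = [set` s] by [].
elim: s {sA} => // g [|h s] IH _.
  exists g => //=; first by rewrite inE.
  by move=> h; rewrite /= inE => /eqP ->.
have [//|k ks kP] := IH.
have [gk|kg] := lerP (f g) (f k).
  exists g => [|l] /=; first by rewrite mem_head.
  by rewrite inE => /orP[/eqP -> //|/kP]; apply: le_trans gk.
exists k => [|l] /=; first by rewrite inE ks orbT.
by rewrite inE => /orP[/eqP ->|/kP //]; exact: ltW.
Qed.

Lemma discrete_closest x p (A : set (eisom R n)) :
  A !=set0 -> A `<=` [set` G] ->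
  exists2 g, A g & forall h, A h -> edist (g x) p <= edist (h x) p.
Proof.
move=> [g0 Ag0] AG.
have [||g [Ag gg0] gP] := @discrete_argmin x p (edist (g0 x) p)
  [set g | A g /\ edist (g x) p <= edist (g0 x) p] (fun g => edist (g x) p).
- by exists g0.
- by move=> g [/AG].
- exists g => // h Ah; have [hg0|/ltW hg0] := lerP (edist (h x) p) (edist (g0 x) p).
    exact: gP.
  exact: le_trans gg0 hg0.
Qed.

(** [d] is the difference between the least distance from [p] to the orbit and the next one, or [1]
    if there is no other. This gap makes closest points vary continuously. *)
Lemma closest_orbit_gap x p : exists2 d : R, 0 < d & forall g h,
  g \in G -> h \in G -> (forall k, k \in G -> edist (g x) p <= edist (k x) p) ->
  edist (h x) p < edist (g x) p + d -> edist (h x) p <= edist (g x) p.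
Proof.
have [g0 g0G g0P] : exists2 g, g \in G &
    forall h, h \in G -> edist (g x) p <= edist (h x) p.
  by apply: (@discrete_closest x p [set` G]) => //; exists 1%g; exact: gpred1.
pose A := [set g | g \in G /\ edist (g0 x) p < edist (g x) p].
have gE g : g \in G -> (forall k, k \in G -> edist (g x) p <= edist (k x) p) ->
    edist (g x) p = edist (g0 x) p.
  by move=> gG gP; apply/le_anti; rewrite gP //= g0P.
have [A0|A0] := pselect (A !=set0); last first.
  exists 1 => // g h gG hG gP _; rewrite leNgt; apply/negP => gh; apply: A0.
  by exists h; split => //; rewrite -(gE g).
have [||g2 [g2G g2A] g2P] := @discrete_closest x p A => //.
  by move=> g [].
exists (edist (g2 x) p - edist (g0 x) p); first by rewrite subr_gt0.
move=> g h gG hG gP; rewrite (gE g) // addrC subrK leNgt => hg2.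
by apply/negP => hg0; move: hg2; rewrite ltNge g2P.
Qed.

End Discreteness.

(** * From a section to reflections *)

Section GenericPoints.
Context {R : realType} {n : nat}.
Local Notation E := ('rV[R]_n).
Implicit Types (x y z a p q : E) (g h : eisom R n).

Lemma small_notin (s : seq R) (e : R) : 0 < e ->
  exists t : R, [/\ 0 < t, t < e & t \notin s].
Proof.
move=> e0; suff [t [t0 te ts]] : exists t : R,
    [/\ 0 < t, t <= e & forall u, u \in s -> 0 < u -> t <= u].
  exists (t / 2); split; [lra | lra |].
  by apply/negP => /ts; rewrite divr_gt0 // => /(_ isT); lra.
elim: s => [|u s [t [t0 te ts]]]; first by exists e; split.
have [u0|u0] := ltrP 0 u.
  exists (Num.min t u); split; rewrite ?lt_min ?t0 // ?ge_min ?te //.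
  move=> v; rewrite inE => /orP[/eqP ->|vs v0]; rewrite ge_min ?lexx ?orbT //.
  by rewrite ts.
exists t; split => // v; rewrite inE => /orP[/eqP -> u1|/ts //].
by move: u0; rewrite leNgt u1.
Qed.

Lemma edist_line x a (t : R) : edist (x + t *: a) x = `|t| * edist a 0.
Proof.
apply/eqP; rewrite -(@eqrXn2 _ 2) ?edist_ge0 ?mulr_ge0 ?edist_ge0 //.
rewrite exprMn !sqr_edist addrAC subrr add0r subr0 real_normK ?num_real //.
by rewrite !edotE; apply/eqP; ring.
Qed.

(** Hyperplanes are treated one at a time, by a small step along the next normal. A hyperplane not
    parallel to the step excludes a single step length; a parallel one is already avoided. *)
Lemma avoid_hyperplanes (I : eqType) (A : set I) (Z : I -> set E) x (e : R) :
  finite_set A -> 0 < e ->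
  (forall i, A i -> exists a, exists b, a != 0 /\ forall y, Z i y -> edot a y = b) ->
  exists2 q, edist q x < e & forall i, A i -> ~ Z i q.
Proof.
move=> /finite_seqP[s ->] e0 ZP.
have /choice[f fP] : forall i, exists ab : E * R, i \in s ->
    ab.1 != 0 /\ forall y, Z i y -> edot ab.1 y = ab.2.
  move=> i; have [is_|is_] := boolP (i \in s); last by exists (0, 0).
  by have [a [b abP]] := ZP i is_; exists (a, b).
suff [q qx qP] : exists2 q, edist q x < e &
    forall i, i \in s -> edot (f i).1 q != (f i).2.
  exists q => // i si Zq; have [_ /(_ _ Zq) /eqP] := fP i si.
  by apply/negP; exact: qP.
have {fP ZP} : forall i, i \in s -> (f i).1 != 0 by move=> i /fP[].
elim: s e e0 => [e e0 _|i s IH e e0 fs]; first by exists x; rewrite ?edistxx.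
have e2 : 0 < e / 2 by rewrite divr_gt0.
have [//||q qx qP] := IH (e / 2).
  by move=> j js; apply: fs; rewrite inE js orbT.
have i0 : (f i).1 != 0 by apply: fs; rewrite mem_head.
set a := (f i).1 in i0.
have d0 : 0 < edist a 0 by rewrite edist_gt0.
have [t [t0 te ts]] := @small_notin
  [seq ((f j).2 - edot (f j).1 q) / edot (f j).1 a | j <- i :: s] (e / 2 / edist a 0)
  (divr_gt0 e2 d0).
exists (q + t *: a).
  apply: le_lt_trans (ler_edistD q _ _) _; rewrite [ltRHS]splitr ltrD //.
  by rewrite edist_line gtr0_norm // -ltr_pdivlMr.
move=> j jis; rewrite edotDr edotZr; apply/eqP => jq.
have [ja|ja] := eqVneq (edot (f j).1 a) 0; last first.
  move/negP: ts; apply; apply/mapP; exists j => //.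
  by apply: (mulIf ja); rewrite divfK // -jq; ring.
move: jis; rewrite inE => /orP[/eqP ji|js].
  by move: ja; rewrite ji -/a => /eqP; rewrite edot_eq0 (negbTE i0).
by move: (qP j js); rewrite -jq ja mulr0 addr0 eqxx.
Qed.

Lemma edot_bisector x y z : edist z x = edist z y ->
  edot (y - x) z = (edot y y - edot x x) / 2.
Proof.
move/edist_eq; rewrite !edotE (edotC z x) (edotC z y); lra.
Qed.

(* The fixed points lie on the bisector of every pair [y], [h y]; two distinct
   bisectors span a pencil, which has a member through [p]. *)
Lemma fixed_points_thin h p : ~ is_affine_reflection h -> h p != p ->
  exists a, exists b, a != 0 /\
    (edot a p = b /\ forall x, h x = x -> edot a x = b).
Proof.
move=> hnr hp.
pose A y := h y - y; pose B y := (edot (h y) (h y) - edot y y) / 2.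
have fixB x y : h x = x -> edot (A y) x = B y.
  by move=> hx; apply: edot_bisector; rewrite -{2}hx eisom_dist.
have Ap0 : A p != 0 by rewrite subr_eq0.
have rp : hyperplane_reflection (A p) (B p) p = h p.
  by apply: reflection_bisector; rewrite eq_sym.
have fp0 : edot (A p) p - B p != 0.
  by rewrite subr_eq0 -reflection_fixE // rp.
(* [h] is not the reflection in the bisector of [p] and [h p], so the two differ at some [x]; the
   pair [x], [h x] gives the second bisector. *)
have [x hx] : exists x, h x <> hyperplane_reflection (A p) (B p) x.
  apply: contrapT => nx; apply: hnr; exists (A p), (B p); split => // x.
  by apply: contrapT => hx; apply: nx; exists x.
have xhx : h x != x.
  apply/eqP => hxx; apply: hx; rewrite hxx; apply/esym/eqP.
  by rewrite reflection_fixE // fixB.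
have Ax0 : A x != 0 by rewrite subr_eq0.
have rx : hyperplane_reflection (A x) (B x) x = h x.
  by apply: reflection_bisector; rewrite eq_sym.
set u := edot (A p) p - B p in fp0; set v := edot (A x) p - B x.
(* [u] and [v] are the values at [p] of the two affine equations, so this combination vanishes at
   [p]. *)
exists (u *: A x - v *: A p), (u * B x - v * B p).
have abp : edot (u *: A x - v *: A p) p = u * B x - v * B p.
  rewrite edotDl edotNl !edotZl.
  have -> : edot (A x) p = v + B x by rewrite subrK.
  have -> : edot (A p) p = u + B p by rewrite subrK.
  ring.
split; last first.
  by split => // y hy; rewrite edotDl edotNl !edotZl !fixB.
(* Were the new normal zero, the bisectors would coincide and the first reflection would send [x] to
   [h x]. *)
clearbody u v A B; apply/eqP => a0; apply: hx; rewrite -rx.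
have Axp : A x = (v / u) *: A p.
  apply: (scalerI fp0); rewrite scalerA mulrCA divff // mulr1.
  by apply/eqP; rewrite -subr_eq0 a0.
have Bxp : B x = v / u * B p.
  apply: (mulfI fp0); apply/eqP; rewrite mulrA (mulrCA u) divff // mulr1 -subr_eq0.
  by rewrite -abp a0 -(scale0r 0) edotZl mul0r.
rewrite Axp Bxp hyperplane_reflectionZ // ; apply: contra Ax0 => /eqP vu0.
by rewrite Axp vu0 scale0r.
Qed.

Variable G : groupClosed (eisom R n).
Hypothesis G_discrete : [set` G] `<=` isolated [set` G].

Lemma trivial_stabilizer_point :
  exists p, forall g, g \in G -> g p = p -> g = 1%g.
Proof.
(* An element fixing a point at distance less than 1 from the origin moves the origin by at most 2,
   so finitely many elements matter; the fixed points of each lie in the bisector of a moved point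
   and its image. *)
have [|||q q0 qP] := @avoid_hyperplanes _
  [set g | (g \in G /\ edist (g 0) 0 <= 2) /\ g <> 1%g]
  (fun g => [set x | g x = x]) 0 1.
- by apply: finite_setIl; exact: discrete_finite.
- exact: ltr01.
- move=> g [_ g1]; have [x gx] : exists x, g x <> x.
    apply: contrapT => nx; apply: g1; apply: eisom_eqP => x.
    by apply: contrapT => gx; apply: nx; exists x.
  exists (g x - x), ((edot (g x) (g x) - edot x x) / 2); split.
    by rewrite subr_eq0; apply/eqP.
  by move=> y /= gy; apply: edot_bisector; rewrite -{2}gy eisom_dist.
- exists q => g gG gq; apply: contrapT => g1; apply: (qP g) => //; split => //.
  split => //; apply: le_trans (ler_edistD q _ _) _.
  rewrite -{1}gq eisom_dist edistC; lra.
Qed.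

End GenericPoints.

Lemma connected_locally_constant (T : topologicalType) (A P : set T) :
  connected A ->
  (forall t, A t -> nbhs t [set u | A u -> (P u <-> P t)]) ->
  forall t u, A t -> A u -> P t -> P u.
Proof.
move=> cA AP t u At Au Pt; suff AE : A `&` P = A by move: Au; rewrite -AE => -[].
apply: cA; first by exists t.
  exists [set v | A v -> P v]^°; first exact: open_interior.
  rewrite predeqE => v; split=> [[Av Pv]|[Av /nbhs_singleton Pv]]; last first.
    by split=> //; exact: Pv.
  by split=> //; apply: filterS (AP v Av) => w h /h [_ ]; apply.
exists (~` [set v | A v -> ~ P v]^°).
  by apply: open_closedC; exact: open_interior.
rewrite predeqE => v; split=> [[Av Pv]|[Av Pv]].
  by split=> // /nbhs_singleton /(_ Av).
split=> //; apply: contrapT => nPv; apply: Pv.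
by apply: filterS (AP v Av) => w h /h [hw _] /hw.
Qed.

(** * Continuous selections of orbit representatives *)

Section OrbitSelection.
Context {R : realType} {n : nat}.
Local Notation E := ('rV[R]_n).
Implicit Types (x y z a p q : E) (g h : eisom R n).
Variable G : groupClosed (eisom R n).
Hypothesis G_discrete : [set` G] `<=` isolated [set` G].
Variable r : E -> E.
Hypothesis r_continuous : continuous r.
Hypothesis r_invariant : forall g x, g \in G -> r (g x) = r x.
Hypothesis r_orbit : forall x, exists2 g, g \in G & g (r x) = x.
Variable H : set (eisom R n).
Hypothesis H_group : group_closed [pred g | g \in H].
Hypothesis H_reflection : forall g, g \in G -> is_affine_reflection g -> H g.

Let H1 : H 1%g.
Proof. by have [/set_mem] := H_group. Qed.

Let HM g h : H g -> H h -> H (g * h)%g.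
Proof.
by move=> Hg Hh; apply/set_mem; apply: (group_closedM H_group); apply/mem_set.
Qed.

Let HV g : H g -> H g^-1%g.
Proof. by move=> Hg; apply/set_mem; apply: (group_closedV H_group); apply/mem_set. Qed.

(* [x] lies in the [H]-saturation of the image of [r]. *)
Definition transported x := exists g, [/\ g \in G, H g & g (r x) = x].

(** If [y] is near [x], with [g (r y) = y] and [h (r x) = x], then by continuity of [r] the element
    [g * h^-1] moves [x] by less than [d]. Hence it fixes [x] and lies in [H], so [g] is in [H] iff
    [h] is. *)
Lemma transported_near x : (forall g, g \in G -> g x = x -> H g) ->
  nbhs x [set y | transported y <-> transported x].
Proof.
move=> xH.
have [d d0 dP] : exists2 d : R, 0 < d & forall g, g \in G ->
    edist (g x) x < d -> g x = x.
  pose A := [set g | g \in G /\ g x <> x].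
  have [A0|A0] := pselect (A !=set0); last first.
    exists 1 => // g gG _; apply: contrapT => gx; apply: A0; by exists g.
  have [g [gG gx] gP] := discrete_closest G_discrete x x A0 (fun h => @proj1 _ _).
  exists (edist (g x) x); first by rewrite edist_gt0; apply/eqP.
  move=> h hG hx; apply: contrapT => hxx.
  by move: hx; rewrite ltNge gP.
have d2 : 0 < d / 2 by rewrite divr_gt0.
have [e e0 eP] := (continuous_edistP r).1 r_continuous x _ d2.
apply/nbhs_edistP; exists (Num.min e (d / 2)); first by rewrite lt_min e0.
move=> y; rewrite lt_min => /andP[/eP rxy xy].
have key g h : g \in G -> h \in G -> g (r y) = y -> h (r x) = x -> H (g * h^-1)%g.
  move=> gG hG gy hx.
  have ghG : (g * h^-1)%g \in G by rewrite gpredM // gpredV.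
  apply: xH => //; apply: dP => //; rewrite eisomME -{1}hx eisomVK.
  apply: le_lt_trans (ler_edistD y _ _) _; rewrite [ltRHS]splitr ltrD //.
    by rewrite -{1}gy eisom_dist.
  by rewrite edistC.
split=> [[g [gG Hg gy]]|[h [hG Hh hx]]].
  have [h hG hx] := r_orbit x; exists h; split => //.
  have := HM (HV (key _ _ gG hG gy hx)) Hg.
  by rewrite invgF -mulgA mulVg mulg1.
have [g gG gy] := r_orbit y; exists g; split => //.
by have := HM (key _ _ gG hG gy hx) Hh; rewrite -mulgA mulVg mulg1.
Qed.

Lemma transported_segment x y :
  (forall t : R, 0 <= t <= 1 -> forall g, g \in G ->
     g (x + t *: (y - x)) = x + t *: (y - x) -> H g) ->
  transported x <-> transported y.
Proof.
move=> xyH; pose c (t : R) := x + t *: (y - x).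
have cc : continuous c.
  by move=> t; apply: cvgD; [exact: cvg_cst | apply: cvgZr_tmp; exact: cvg_id].
have cA : connected `[(0 : R), 1] by exact: segment_connected.
have loc t : `[(0 : R), 1]%classic t ->
    nbhs t [set u | `[(0 : R), 1]%classic u -> (transported (c u) <-> transported (c t))].
  rewrite /= in_itv /= => t01.
  have h : nbhs t (c @^-1` [set y | transported y <-> transported (c t)]).
    exact: cc (transported_near (xyH t t01)).
  by apply: filterS h => u hu _.
have i0 : `[(0 : R), 1]%classic 0 by rewrite /= in_itv /= lexx ler01.
have i1 : `[(0 : R), 1]%classic 1 by rewrite /= in_itv /= lexx ler01.
have c0 : c 0 = x by rewrite /c scale0r addr0.
have c1 : c 1 = y by rewrite /c scale1r addrC subrK.
rewrite -{1}c0 -c1; split.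
  exact: (connected_locally_constant (P := transported \o c) cA loc).
exact: (connected_locally_constant (P := transported \o c) cA loc).
Qed.

Lemma orbit_selection_reflections : [set` G] `<=` H.
Proof.
have [q0 q0P] := trivial_stabilizer_point G_discrete.
have [g1 g1G g1q] := r_orbit q0.
set p := r q0 in g1q.
have pP g : g \in G -> g p = p -> g = 1%g.
  move=> gG gp; have : (g1 * g * g1^-1)%g = 1%g.
    apply: q0P; first by rewrite !gpredM // gpredV.
    by rewrite !eisomME -{1}g1q eisomVK gp.
  by move=> /divg1_eq; rewrite -[RHS]mulg1 => /mulgI.
have rp : r p = p by rewrite -(r_invariant p g1G) g1q.
move=> g0 /= g0G; pose pt (c : bool) := if c then p else g0 p.
have ptP c g : g \in G -> g (pt c) = pt c -> g = 1%g.
  case: c => /= gG; first exact: pP.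
  move=> gp; have : (g0^-1 * g * g0)%g = 1%g.
    apply: pP; first by rewrite !gpredM // gpredV.
    by rewrite !eisomME gp eisomVK.
  by rewrite -mulgA => /mulg1_eq; rewrite invgK -[LHS]mul1g => /mulIg.
(* With [q] within 1 of [p], the segments from [p] and [g0 p] to [q] stay within
   [1 + 2 * edist (g0 p) p] of [p]; an element fixing one of their points moves [p] by at most twice
   that. *)
pose B := 2 * (1 + 2 * edist (g0 p) p).
(* The sets to avoid are the cones from both endpoints over the fixed points of elements outside
   [H]. By [fixed_points_thin] these fixed points lie in a hyperplane through the endpoint, which
   then contains the cone. *)
have [|||q qp qP] := @avoid_hyperplanes _ _ _
  ([set g | (g \in G /\ edist (g p) p <= B) /\ ~ H g] `*` [set: bool])
  (fun gc => [set y | exists2 t : R, 0 < t &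
     gc.1 (pt gc.2 + t *: (y - pt gc.2)) = pt gc.2 + t *: (y - pt gc.2)]) p 1.
- apply: finite_setX; last exact: finite_finset.
  by apply: finite_setIl; exact: discrete_finite.
- exact: ltr01.
- move=> [h c] [/= [[hG _] nHh] _].
  have hc : h (pt c) != pt c.
    by apply/eqP => /ptP h1; apply: nHh; rewrite h1.
  have nh : ~ is_affine_reflection h by move=> /H_reflection; apply: contra_not nHh; apply.
  have [a [b [a0 [ap aP]]]] := fixed_points_thin nh hc.
  exists a, b; split=> // y [t t0 /aP]; rewrite !edotE ap => /eqP.
  rewrite -subr_eq0 addrAC subrr add0r mulf_eq0 gt_eqF //= subr_eq0.
  by move=> /eqP.
have step c : transported (pt c) <-> transported q.
  apply: transported_segment => t /andP[t0 t1] h hG.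
  set x := _ + _ => hx; apply: contrapT => nHh.
  have [t_eq0|t_neq0] := eqVneq t 0.
    apply: nHh; rewrite (ptP c h hG _) //.
    by move: hx; rewrite /x t_eq0 scale0r addr0.
  apply: (qP (h, c)); last by exists t => //=; rewrite lt_def t_neq0.
  do 2 split => //; split => //.
  apply: le_trans (ler_edistD x _ _) _; rewrite -{1}hx eisom_dist.
  rewrite (edistC p x) /B mulr_natl mulr2n.
  suff : edist x p <= 1 + 2 * edist (g0 p) p by move=> h1; rewrite lerD.
  apply: le_trans (ler_edistD (pt c) _ _) _.
  have xc : edist x (pt c) <= edist q (pt c).
    rewrite edist_line ger0_norm //; apply: le_trans (ler_wpM2r (edist_ge0 _ _) t1) _.
    by rewrite mul1r /Defs.edist subr0.
  have cp : edist (pt c) p <= edist (g0 p) p.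
    by case: c {x hx xc} => //=; rewrite edistxx edist_ge0.
  have := ler_edistD p q (pt c); rewrite (edistC p); lra.
have : transported p by exists 1%g; split => //; exact: gpred1.
(* As [r (g0 p) = p], the transporting element [h] sends [p] to [g0 p]; triviality of the stabilizer
   of [p] identifies it with [g0]. *)
move/(step true).1/(step false).2 => /= [h [hG Hh]].
rewrite r_invariant // rp => hp.
suff -> : g0 = h by [].
have : (h^-1 * g0)%g = 1%g.
  by apply: pP; [rewrite gpredM // gpredV | rewrite eisomME -hp eisomVK].
by move=> hg; rewrite -(mulVKg h g0) hg mulg1.
Qed.

End OrbitSelection.

(** * From reflections to a section *)

Section Chamber.
Context {R : realType} {n : nat}.
Local Notation E := ('rV[R]_n).
Implicit Types (x y z a p q : E) (g h s t r : eisom R n).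

Lemma affine_reflection_neq1 t : is_affine_reflection t -> t <> 1%g.
Proof.
move=> [a [b [a0 tE]]] t1.
have fixE x : edot a x = b.
  by apply/eqP; rewrite -reflection_fixE // -tE t1 eisom1E.
move: (a0); rewrite -edot_eq0 fixE -(fixE 0) -(scale0r 0) edotZr mul0r.
by rewrite eqxx.
Qed.

Lemma affine_reflectionK t : is_affine_reflection t -> involutive t.
Proof. by move=> /affine_reflection_invol tt x; rewrite -eisomME tt. Qed.

Lemma affine_reflectionV t : is_affine_reflection t -> t^-1%g = t.
Proof. by move=> /affine_reflection_invol /mulg1_eq. Qed.

Variable G : groupClosed (eisom R n).
Hypothesis G_discrete : [set` G] `<=` isolated [set` G].
Variable p : E.
Hypothesis p_stab : forall g, g \in G -> g p = p -> g = 1%g.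

Definition reflection_in t := t \in G /\ is_affine_reflection t.

Lemma reflection_in_conj g t : g \in G -> reflection_in t ->
  reflection_in (g * t * g^-1)%g.
Proof.
move=> gG [tG tr]; split; last exact: affine_reflection_conj.
by rewrite !gpredM // gpredV.
Qed.

(** Normalized so that [edot a x - b] is the signed distance to the mirror, positive on the side of
    [p]. *)
Definition mirror t a (b : R) :=
  [/\ edot a a = 1, 0 < edot a p - b & t =1 hyperplane_reflection a b].

Lemma reflection_mirror t : reflection_in t -> exists a, exists b, mirror t a b.
Proof.
move=> [tG tr]; apply: affine_reflection_unit => //; apply/eqP => tp.
by apply: (affine_reflection_neq1 tr); exact: p_stab.
Qed.

Lemma mirror_le t a (b : R) x y : mirror t a b ->
  (edist x y <= edist x (t y)) = (0 <= (edot a x - b) * (edot a y - b)).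
Proof.
move=> [a1 _ tE]; rewrite le_edist tE edot_reflection // lerDl.
by rewrite pmulr_rge0.
Qed.

Lemma mirror_lt t a (b : R) x y : mirror t a b ->
  (edist x (t y) < edist x y) = ((edot a x - b) * (edot a y - b) < 0).
Proof. by move=> m; rewrite !ltNge -(mirror_le _ _ m). Qed.

Lemma mirror_ge t a (b : R) x y : mirror t a b ->
  (edist x (t y) <= edist x y) = ((edot a x - b) * (edot a y - b) <= 0).
Proof.
move=> [a1 _ tE]; rewrite le_edist tE edot_reflection // gerDl.
by rewrite pmulr_rle0.
Qed.

Lemma mirror_fix t a (b : R) x : mirror t a b -> (t x == x) = (edot a x - b == 0).
Proof.
move=> [a1 _ tE]; rewrite tE reflection_fixE ?subr_eq0 //.
by rewrite -edot_gt0 a1.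
Qed.

Lemma mirror_image t a (b : R) x c : mirror t a b ->
  edot c (t x) = edot c x - 2 * (edot a x - b) * edot c a.
Proof.
by move=> [a1 _ tE]; rewrite tE hyperplane_reflection_unit // !edotE.
Qed.

Lemma mirror_edist t a (b : R) x : mirror t a b ->
  edist (t x) x = 2 * `|edot a x - b|.
Proof.
move=> [a1 _ tE]; apply/eqP; rewrite edistC.
rewrite -(@eqrXn2 _ 2) ?edist_ge0 ?mulr_ge0 // sqr_edist exprMn.
rewrite tE edot_reflection // real_normK ?num_real //.
by rewrite subrr -{1}(scale0r 0) edotZl mul0r; apply/eqP; ring.
Qed.

(* A reflection [t] separates [x] and [y] iff [edist x (t y) < edist x y]. Thus
   [y] is in the chamber iff no mirror strictly separates it from [p], and [s] is
   simple iff its mirror is the only one separating [p] and [s p]. *)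
Definition chamber y := forall t, reflection_in t -> edist y p <= edist y (t p).

Definition simple s := reflection_in s /\ forall t, reflection_in t -> t <> s ->
  edist p (s p) < edist p (t (s p)).

(* [c] is the point where the segment from [p] to [z] leaves the chamber; of the
   mirrors through [c], one nearest to [p] is a wall of the chamber. *)
Lemma simple_separates z t : reflection_in t -> edist z (t p) < edist z p ->
  exists2 s, simple s & edist z (s p) < edist z p.
Proof.
(* The quadratic terms in [x] cancel, so [phi t] is affine; it is negative where [x] is closer to
   [t p] than to [p]. *)
pose phi t x := edot (x - t p) (x - t p) - edot (x - p) (x - p).
have phiE t0 x y (k : R) : phi t0 (x + k *: (y - x)) = (1 - k) * phi t0 x + k * phi t0 y.
  rewrite /phi !edotE (edotC (t0 p) x) (edotC (t0 p) y) (edotC p x) (edotC p y).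
  rewrite (edotC y x); ring.
have phip t0 : reflection_in t0 -> 0 < phi t0 p.
  move=> /reflection_mirror[a [b m]]; rewrite /phi subr_gt0 -lt_edist edistxx.
  rewrite edist_gt0 eq_sym (mirror_fix _ m) gt_eqF //; by case: m.
have philt t0 x : (edist x (t0 p) < edist x p) = (phi t0 x < 0).
  by rewrite lt_edist subr_lt0.
have phile t0 x : (edist x p <= edist x (t0 p)) = (0 <= phi t0 x).
  by rewrite le_edist subr_ge0.
move=> tr; rewrite philt => tz.
(* The minimized quotient is the parameter at which the segment from [p] to [z] crosses the mirror
   of [t]; that of [t0] is crossed first. *)
have [||t0 [t0r t0z] t0P] := @discrete_argmin _ _ _ G_discrete p p
    (2 * edist z p) [set t | reflection_in t /\ phi t z < 0]
    (fun t => phi t p / (phi t p - phi t z)).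
- by exists t.
- move=> t1 [[t1G t1r]]; rewrite -philt => t1z; split => //.
  have := ler_edistD z (t1 p) p; rewrite (edistC _ z); lra.
have t0p := phip _ t0r.
set k := phi t0 p / (phi t0 p - phi t0 z) in t0P.
have k0 : 0 < k by rewrite divr_gt0 // subr_gt0 (lt_trans t0z).
have k1 : k < 1 by rewrite ltr_pdivrMr ?mul1r; lra.
pose c := p + k *: (z - p).
have t0c : phi t0 c = 0 by rewrite phiE /k; field; rewrite gt_eqF //; lra.
have cC t1 : reflection_in t1 -> 0 <= phi t1 c.
  move=> t1r; have t1p := phip _ t1r; rewrite phiE.
  have [t1z|t1z] := lerP 0 (phi t1 z).
    by rewrite addr_ge0 // mulr_ge0 // ?ltW // subr_gt0.
  have := t0P t1 (conj t1r t1z).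
  by rewrite ler_pdivlMr; [move: k0 k1; nra | lra].
have cz t1 : reflection_in t1 -> phi t1 c = 0 -> phi t1 z < 0.
  move=> t1r; have t1p := phip _ t1r; rewrite phiE => t1c.
  have : 0 < (1 - k) * phi t1 p by rewrite mulr_gt0 // subr_gt0.
  by rewrite -(pmulr_rlt0 _ k0); lra.
have [||s [sr sc] sP] := discrete_closest G_discrete p p
    (A := [set t | reflection_in t /\ phi t c = 0]).
- by exists t0.
- by move=> t1 [[]].
have c_eq t1 : phi t1 c = 0 -> edist c (t1 p) = edist c p.
  by move=> /eqP; rewrite subr_eq0 /Defs.edist => /eqP ->.
have [a [b m]] := reflection_mirror sr; have [a1 ap sE] := m.
have sinv := affine_reflectionK sr.2.
have fc : edot a c - b = 0.
  have := mirror_le c p m; have := mirror_ge c p m.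
  rewrite c_eq // lexx => /esym h1 /esym h2.
  have : (edot a c - b) * (edot a p - b) == 0 by rewrite eq_le h1.
  by rewrite mulf_eq0 (gt_eqF ap) orbF => /eqP.
have sc_c : s c = c by apply/eqP; rewrite (mirror_fix _ m) fc.
exists s; last by rewrite philt; exact: cz.
split => // t2 t2r t2s; rewrite ltNge; apply/negP => t2p.
have [a2 [b2 m2]] := reflection_mirror t2r; have [a21 a2p t2E] := m2.
(* The mirrors of [t2] and of its conjugate [u] both pass through [c], so neither is nearer to [p]
   than that of [s]. The two inequalities add up to [1 <= edot a2 a], which for unit normals forces
   [a2 = a], and then [t2 = s]. *)
pose u := (s * t2 * s^-1)%g.
have ur : reflection_in u by apply: reflection_in_conj => //; case: sr.
have uE x : u x = s (t2 (s x)) by rewrite /u !eisomME affine_reflectionV ?sr.2 //; case: sr.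
have cup : edist c (u p) = edist c (t2 (s p)).
  by rewrite uE -{1}sc_c eisom_dist.
have csp : edist c (s p) = edist c p by exact: c_eq.
have f2sp : edot a2 (s p) - b2 < 0.
  move: t2p; rewrite (mirror_ge _ _ m2) pmulr_rle0 // le_eqVlt => /orP[|//].
  rewrite -(mirror_fix _ m2) => /eqP t2sp; exfalso.
  apply: (affine_reflection_neq1 ur.2); apply: p_stab; first by case: ur.
  by rewrite uE t2sp sinv.
have f2c : edot a2 c - b2 = 0.
  apply/le_anti/andP; split.
    have := cC u ur; rewrite -phile cup -csp (mirror_le _ _ m2).
    by rewrite nmulr_lge0.
  by have := cC t2 t2r; rewrite -phile (mirror_le _ _ m2) pmulr_lge0.
have t2c : t2 c = c by apply/eqP; rewrite (mirror_fix _ m2) f2c.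
have phi0 t1 : edist c (t1 p) = edist c p -> phi t1 c = 0.
  by move=> /edist_eq h; rewrite /phi h subrr.
have h2 : edot a p - b <= edot a2 p - b2.
  have := sP t2 (conj t2r (phi0 t2 _)).
  rewrite (mirror_edist _ m) (mirror_edist _ m2) !gtr0_norm //.
  rewrite ler_pM2l //; apply; by rewrite -{1}t2c eisom_dist.
have hu : edot a p - b <= - (edot a2 (s p) - b2).
  have := sP u (conj ur (phi0 u _)).
  have -> : edist (u p) p = edist (t2 (s p)) (s p).
    by rewrite uE -{2}[p]sinv eisom_dist.
  rewrite (mirror_edist _ m) (mirror_edist _ m2) gtr0_norm // ltr0_norm //.
  rewrite ler_pM2l //; apply.
  by rewrite cup -{1}t2c eisom_dist csp.
have a_eq : a2 = a.
  apply/eqP; rewrite -subr_eq0 -edot_eq0 eq_le edot_ge0 andbT.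
  move: hu; rewrite (mirror_image _ _ m) => hu.
  have : 1 <= edot a2 a.
    by rewrite -(ler_pM2l ap) mulr1; lra.
  by rewrite !edotE a1 a21 (edotC a a2); lra.
apply: t2s; apply: eisom_eqP => x; rewrite t2E sE a_eq.
suff -> : b2 = b by [].
by move: fc f2c; rewrite a_eq; lra.
Qed.

Fixpoint simple_word (k : nat) g : Prop :=
  if k is j.+1 then exists s, exists h, [/\ simple s, simple_word j h & g = (s * h)%g]
  else g = 1%g.

Lemma simple_word_in k g : simple_word k g -> g \in G.
Proof.
elim: k g => [g ->|k IH g [s [h [[[sG _] _] /IH hG ->]]]]; first exact: gpred1.
exact: gpredM.
Qed.

Lemma simple_word1 s : simple s -> simple_word 1 s.
Proof. by move=> ss; exists s, 1%g; split => //; rewrite mulg1. Qed.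

Lemma simple_wordM j k g h :
  simple_word j g -> simple_word k h -> simple_word (j + k) (g * h)%g.
Proof.
elim: j g => [g /= -> |j IH g [s [g' [ss /IH gw ->]]] /gw hw]; first by rewrite mul1g.
by exists s, (g' * h)%g; split => //; rewrite mulgA.
Qed.

Lemma simple_wordV k g : simple_word k g -> simple_word k g^-1%g.
Proof.
elim: k g => [g -> /=|k IH g [s [h [ss /IH hw ->]]]]; first by rewrite invg1.
rewrite invgM (affine_reflectionV ss.1.2) -addn1.
by apply: simple_wordM => //; exact: simple_word1.
Qed.

(* Among the conjugates of [t] by products of simple reflections, one whose mirror
   is nearest to [p] is simple. *)
Lemma reflection_simple_word t : reflection_in t -> exists k, simple_word k t.
Proof.
move=> tr.
pose A := [set g | exists k, exists2 w, simple_word k w & g = (w * t * w^-1)%g].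
have [||t' [k [w kw t'E]] t'P] := discrete_closest G_discrete p p (A := A).
- by exists t; exists 0, 1%g => //; rewrite invg1 mulg1 mul1g.
- move=> _ [k [w /simple_word_in wG ->]]; exact: (reflection_in_conj wG tr).1.
have t'r : reflection_in t'.
  by rewrite t'E; apply: reflection_in_conj => //; exact: simple_word_in kw.
have [t's|t'ns] := pselect (simple t').
  exists (k + (1 + k))%N; have -> : t = (w^-1 * (t' * w))%g.
    by rewrite t'E -!mulgA mulVg mulg1 mulKg.
  apply: simple_wordM; first exact: simple_wordV.
  by apply: simple_wordM => //; exact: simple_word1.
exfalso.
(* A simple [s] separates [p] from [t' p], so [edot a a'] is positive and [s p], still on the side
   of [p], is nearer than [p] to the mirror of [t']. Conjugating [t'] by [s] then contradicts the
   choice of [t']. *)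
have [a' [b' m']] := reflection_mirror t'r; have [a1' ap' _] := m'.
have [|s ss] := @simple_separates (t' p) t' t'r.
  by rewrite edistxx edist_gt0 (mirror_fix _ m') gt_eqF.
have [a [b m]] := reflection_mirror ss.1; have [a1 ap _] := m.
rewrite (mirror_lt _ _ m) pmulr_llt0 // => sp.
have sV := affine_reflectionV ss.1.2.
have h1 : edist (t' p) p <= edist (t' (s p)) (s p).
  have <- : edist ((s * t' * s^-1)%g p) p = edist (t' (s p)) (s p).
    by rewrite sV !eisomME -{2}[p](affine_reflectionK ss.1.2) eisom_dist.
  apply: t'P.
  exists (1 + k)%N, (s * w)%g; first exact: simple_wordM (simple_word1 ss) kw.
  by rewrite invgM t'E sV !mulgA.
have h2 : 0 < edot a' (s p) - b'.
  have t's : t' <> s by move=> h; apply: t'ns; rewrite h.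
  have := ss.2 t' t'r t's.
  by rewrite ltNge (mirror_ge _ _ m') -ltNge pmulr_rgt0.
move: h1; rewrite !(mirror_edist _ m') !gtr0_norm // ler_pM2l //.
move: sp h2; rewrite (mirror_image _ _ m) (mirror_image _ _ m') (edotC a' a).
move: (edot a a') (edot a p) (edot a' p) ap ap' => u v w' ap ap'.
nra.
Qed.

(** If [t] is the first letter [s], it cancels. Otherwise [t] does not separate [p] from [s p], so
    it separates [s p] from [g p]; then [s^-1 * t * s] separates [p] from [h p], and induction
    applies to [h]. *)
Lemma exchange k g t : simple_word k g -> reflection_in t ->
  edist p (t (g p)) < edist p (g p) ->
  exists2 j, (j < k)%N & simple_word j (t * g)%g.
Proof.
elim: k g t => [g t ->|k IH _ t [s [h [ss hw ->]]]] tr tp.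
  by move: tp; rewrite eisom1E edistxx ltNge edist_ge0.
have [->|ts] := pselect (t = s).
  by exists k => //; rewrite mulgA (affine_reflection_invol ss.1.2) mul1g.
have [a [b m]] := reflection_mirror tr; have [a1 ap _] := m.
pose t' := (s^-1 * t * s^-1^-1)%g.
have t'r : reflection_in t' by apply: reflection_in_conj => //; rewrite gpredV; case: ss => -[].
have [|j jk jw] := IH h t' hw t'r.
  have spos : 0 < edot a (s p) - b.
    have := ss.2 t tr ts.
    by rewrite ltNge (mirror_ge _ _ m) -ltNge pmulr_rgt0.
  rewrite /t' invgK !eisomME -(eisom_dist s) eisomKV -(eisom_dist s p (h p)).
  move: tp; rewrite !(mirror_lt _ _ m) eisomME.
  by rewrite pmulr_rlt0 // pmulr_rlt0.
exists j.+1 => //; exists s, (t' * h)%g; split => //.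
by rewrite /t' invgK !mulgA mulgV mul1g.
Qed.

(** Write [g = s * h]. If [s] separates [p] from [g p], then [g y] lies on the mirror of [s], so
    [h y = g y] with [h] shorter. Otherwise [s] separates [p] from [h p], and [exchange] gives a
    shorter word for [g]. *)
Lemma chamber_orbit_unique k g y :
  simple_word k g -> chamber y -> chamber (g y) -> g y = y.
Proof.
elim/ltn_ind: k g => -[|k] IH g; first by move=> ->.
move=> gw yC gyC; have gG := simple_word_in gw.
have [s [h [ss hw gE]]] := gw.
have hG := simple_word_in hw.
have [a [b m]] := reflection_mirror ss.1; have [a1 ap _] := m.
have sgE : (s * g)%g = h by rewrite gE mulgA (affine_reflection_invol ss.1.2) mul1g.
have [sep|nsep] := ltrP (edist p (s (g p))) (edist p (g p)).
  have gpneg : edot a (g p) - b < 0 by move: sep; rewrite (mirror_lt _ _ m) pmulr_rlt0.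
  have sgy : s (g y) = g y.
    apply/eqP; rewrite (mirror_fix _ m) eq_le; apply/andP; split.
      (* Testing [y] against this conjugate puts [g y] on the same side of the mirror of [s] as
         [g p], or on the mirror. *)
      have /yC : reflection_in (g^-1 * s * g^-1^-1)%g.
        by apply: reflection_in_conj; [rewrite gpredV | case: ss].
      rewrite invgK !eisomME -(eisom_dist g) -(eisom_dist g y (_ _)) eisomKV.
      by rewrite (mirror_le _ _ m) nmulr_lge0.
    by have := gyC s ss.1; rewrite (mirror_le _ _ m) pmulr_lge0.
  have hy : h y = g y by rewrite -sgE.
  by rewrite -hy; apply: (IH k _ h hw yC); rewrite ?hy.
have hp : edist p (s (h p)) < edist p (h p).
  rewrite lt_neqAle; apply/andP; split; last first.
    by rewrite -[(s (h p))]eisomME -gE (le_trans nsep) // -eisomME sgE.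
  (* Equality would put [h p] on the mirror of [s], and a conjugate of [s] would fix [p]. *)
  apply/negP => /eqP hp0.
  have : edot a (h p) - b == 0.
    have := mirror_ge p (h p) m; have := mirror_le p (h p) m.
    rewrite hp0 lexx => /esym h1 /esym h2.
    have : (edot a p - b) * (edot a (h p) - b) == 0 by rewrite eq_le h1 h2.
    by rewrite mulf_eq0 (gt_eqF ap).
  rewrite -(mirror_fix _ m) => /eqP shp.
  have cr : reflection_in (h^-1 * s * h^-1^-1)%g.
    by apply: reflection_in_conj; [rewrite gpredV | case: ss].
  apply: (affine_reflection_neq1 cr.2); apply: p_stab; first by case: cr.
  by rewrite invgK !eisomME shp eisomVK.
have [j jk jw] := exchange hw ss.1 hp.
by apply: (IH j) => //; [exact: ltnW | rewrite gE].
Qed.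

End Chamber.

(** * Sections of the orbit map *)

Section Quotient.
Context {R : realType} {n : nat}.
Local Notation E := ('rV[R]_n).
Implicit Types (x y p : E) (g : eisom R n).
Variable G : groupClosed (eisom R n).
Hypothesis G_discrete : [set` G] `<=` isolated [set` G].

Lemma orbit_mapP x y :
  orbit_map G x = orbit_map G y <-> exists2 g, g \in G & g x = y.
Proof.
split=> [/eqmodP /asboolP //|xy].
by apply/eqmodP/asboolP.
Qed.

Lemma section_reflections (s : orbit_space G -> E) (H : set (eisom R n)) :
  continuous s -> cancel s (orbit_map G) ->
  group_closed [pred g | g \in H] ->
  (forall g, g \in G -> is_affine_reflection g -> H g) -> [set` G] `<=` H.
Proof.
move=> cs sK; apply: (@orbit_selection_reflections _ _ _ G_discrete (s \o orbit_map G)).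
- exact/quotient_continuous.
- move=> g x gG /=; congr s; apply/esym/orbit_mapP; by exists g.
- by move=> x; apply/orbit_mapP; rewrite /= sK.
Qed.

Lemma reflections_section :
  (forall p, (forall g, g \in G -> g p = p -> g = 1%g) ->
     forall g, g \in G -> exists k, simple_word G p k g) ->
  exists s : orbit_space G -> E, continuous s /\ cancel s (orbit_map G).
Proof.
move=> Gword; have [p p_stab] := trivial_stabilizer_point G_discrete.
pose closest x y := (exists2 g, g \in G & g x = y) /\
  forall g, g \in G -> edist y p <= edist (g x) p.
have closest_ex x : exists y, closest x y.
  have [||g gG gP] := discrete_closest G_discrete x p (A := [set` G]) => //.
    by exists 1%g; exact: gpred1.
  by exists (g x); split => //; exists g.
(* [g x] is as far from [t p] as [t (g x)], a point of the same orbit, is from [p]. *)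
have closest_chamber x y : closest x y -> chamber G p y.
  move=> [[g gG <-] gP] t [tG tr].
  rewrite -(eisom_dist t (g x) (t p)) affine_reflectionK // -eisomME.
  by apply: gP; exact: gpredM.
have closest_unique x y y' : closest x y -> closest x y' -> y = y'.
  move=> xy xy'; have yC := closest_chamber _ _ xy.
  have yC' := closest_chamber _ _ xy'.
  have [[g gG gx] _] := xy; have [[h hG hx] _] := xy'.
  have hgG : (h * g^-1)%g \in G by rewrite gpredM // gpredV.
  have y'E : (h * g^-1)%g y = y' by rewrite eisomME -gx eisomVK.
  have [k kw] := Gword p p_stab _ hgG.
  rewrite -y'E; apply/esym; apply: (chamber_orbit_unique p_stab kw yC).
  by rewrite y'E.
have closest_orbit g x y : g \in G -> closest (g x) y -> closest x y.
  move=> gG [[h hG hx] hP]; split; first by exists (h * g)%g => //; exact: gpredM.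
  move=> k kG; have := hP (k * g^-1)%g.
  by rewrite eisomME eisomVK; apply; rewrite gpredM // gpredV.
have [c cP] := choice closest_ex.
pose s (o : orbit_space G) := c (repr o).
have sP x : closest x (s (orbit_map G x)).
  have /orbit_mapP[g gG gx] : orbit_map G x = orbit_map G (repr (orbit_map G x)).
    by rewrite /orbit_map reprK.
  by apply: (closest_orbit g) => //; rewrite gx; exact: cP.
exists s; split; last first.
  move=> o; rewrite -[RHS](reprK o); apply/esym/orbit_mapP.
  by have [] := cP (repr o).
(* For [y] near [x], let [g y] be the point chosen for [y]. Two triangle inequalities, each costing
   less than [d / 2], put [g x] within the gap of the minimum. So [g x] is the point chosen for [x],
   and the chosen points are exactly [edist x y] apart. *)
apply/quotient_continuous/continuous_edistP => x e e0.
have [[g0 g0G g0x] g0P] := sP x.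
have [d d0 dP] := closest_orbit_gap G_discrete x p.
exists (Num.min e (d / 2)); first by rewrite lt_min e0 divr_gt0.
move=> y; rewrite lt_min => /andP[xye xyd] /=.
have [[g gG gy] gP] := sP y.
suff gx : g x = s (orbit_map G x) by rewrite -gx -gy eisom_dist.
apply: (closest_unique x) (sP x); split; first by exists g.
have h : edist (g x) p <= edist (g0 x) p.
  apply: dP => //; first by move=> k kG; rewrite g0x; exact: g0P.
  have h1 := ler_edistD (g y) (g x) p; have h2 := ler_edistD (g0 x) (g0 y) p.
  have := gP g0 g0G; rewrite -gy; move: h1 h2; rewrite !eisom_dist (edistC y x).
  by move: xyd; lra.
by move=> k kG; apply: le_trans h _; rewrite g0x; exact: g0P.
Qed.

End Quotient.

Unset Implicit Arguments.
Set Strict Implicit.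
Set Printing Implicit Defensive.

Theorem corollary8 (R : realType) (n : nat) (G : groupClosed (eisom R n))
    (G_discrete : [set` G] `<=` isolated [set` G]) :
  (exists s : orbit_space G -> 'rV[R]_n,
      continuous s /\ cancel s (orbit_map G))
  <->
  generated_subgroup
    ([set` G] `&` [set g : eisom R n | is_affine_reflection g]) = [set` G].
Proof.
split=> [[s [cs sK]]|genG].
  rewrite predeqE => g; split=> [|gG H [Hgroup HT]].
    apply; split; last by move=> t [].
    split=> [|u v]; rewrite /= !inE /=; first exact: gpred1.
    by move=> uG vG; rewrite gpredM ?gpredV.
  apply: (section_reflections G_discrete cs sK Hgroup _ gG).
  by move=> t tG tr; apply: HT.
apply: (reflections_section G_discrete) => p p_stab g gG.
have : [set` G] g by [].
(* Products of simple reflections form a subgroup containing every reflection of [G], hence all of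
   [G]. *)
rewrite -genG => /(_ [set h | exists k, simple_word G p k h]); apply; split.
  split=> [|u v]; rewrite !inE /=; first by exists 0%N.
  move=> [j ju] [k kv]; exists (j + k)%N.
  by apply: simple_wordM => //; exact: simple_wordV.
by move=> t [tG tr]; exact: (reflection_simple_word G_discrete p_stab).
Qed.
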